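(* There exist sets $E_i\subseteq\mathbb{N}$, $i\ge1$, such that $E=\bigcup_{i\ge1}E_i$ is thin (hence Besicovitch) and primitive, and such that for all large enough $K_i$ (i.e. there are bounds $k_i\in\mathbb{N}$, $i\ge 1$, such that this holds for all $K_i\in\mathbb{N}$ with $K_i\ge k_i$) and all sets $\emptyset\ne A_i\subseteq[K_i,\infty)\cap\mathbb{N}$, the set $B=\bigcup_{i\ge1}E_iA_i$ satisfies $d^*(\mathcal{M}_E\setminus\mathcal{M}_B)>0$. If additionally all $A_i$ are Behrend sets, then $B'=E$.
   Context: $\mathbb{N}=\{1,2,\dots\}$. For $X,Y\subseteq\mathbb{N}$ and $c\in\mathbb{N}$, $XY=\{xy:x\in X,y\in Y\}$ and $cX=\{cx:x\in X\}$. For $B\subseteq\mathbb{N}$ let $\mathcal{M}_B=\bigcup_{b\in B}b\mathbb{Z}$. For $A\subseteq\mathbb{Z}$, the natural density is $d(A)=\lim_{n\to\infty}\frac1n|A\cap[1,n]|$ (if it exists), the upper Banach density is $d^*(A)=\limsup_{n\to\infty}\sup_{k}\frac1n|A\cap[k+1,k+n]|$, and the logarithmic density is $\delta(A)=\lim_{n\to\infty}\frac{1}{\ln n}\sum_{1\le k\le n,\,k\in A}\frac1k$; $\delta(\mathcal{M}_B)$ exists for every $B\subseteq\mathbb{N}$ (Davenport--Erdős). $B$ is Besicovitch if $d(\mathcal{M}_B)$ exists. $B$ is thin if $\sum_{b\in B}1/b<\infty$. $B$ is primitive if $b\mid b'$ with $b,b'\in B$ implies $b=b'$; $B^{prim}=B\setminus\bigcup_{k\ge2}kB$.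 $B$ is taut if $\delta(\mathcal{M}_{B\setminus\{b\}})<\delta(\mathcal{M}_B)$ for every $b\in B$. $B$ is Behrend if $B\subseteq\mathbb{N}\setminus\{1\}$ and $\delta(\mathcal{M}_B)=1$. Tautification: put $C(B)=\{c\in\mathbb{N}: cA\subseteq B\text{ for some Behrend set }A\}$; the tautification of $B$ is $B'=(B\cup C(B))^{prim}$. (Equivalently, $B'$ is the unique taut set whose Mirsky measure equals that of $B$, where the Mirsky measure of $B$ is the shift-invariant measure on $\{0,1\}^{\mathbb{Z}}$ for which $\mathbf{1}_{\mathbb{Z}\setminus\mathcal{M}_B}$ is quasi-generic along any sequence realizing the lower density of $\mathcal{M}_B$.) *)

(* Defs.v *)
From HB Require Import structures.
From mathcomp Require Import all_boot all_order all_algebra.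
From mathcomp Require Import all_classical all_reals all_analysis.

Set Implicit Arguments.
Unset Strict Implicit.
Unset Printing Implicit Defensive.

Import Order.TTheory GRing.Theory Num.Theory.
Import numFieldNormedType.Exports.

Local Open Scope classical_set_scope.
Local Open Scope ring_scope.

(* Subsets of N = {1, 2, ...} are modelled as sets of type [set nat] included
   in [posnat]; subsets of Z are of type [set int]. *)
Definition posnat : set nat := [set n | (0 < n)%N].

Definition prodset (X Y : set nat) : set nat :=
  [set (x * y)%N | x in X & y in Y].

Definition dilate (c : nat) (X : set nat) : set nat :=
  [set (c * x)%N | x in X].

Definition multiples (B : set nat) : set int :=
  \bigcup_(b in B) [set z : int | (b%:Z %| z)%Z].

(* The cardinality of A `&` [k + 1, k + n]. *)
Definition count_window (A : set int) (k : int) (n : nat) : nat :=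
  (\sum_(1 <= i < n.+1) ((k + i%:Z)%R \in A))%N.

Definition has_density (R : realType) (A : set int) (l : R) : Prop :=
  ((count_window A 0 n)%:R / n%:R : R) @[n --> \oo] --> l.

Definition upper_Banach_density (R : realType) (A : set int) : \bar R :=
  limn_esup (fun n : nat =>
    ereal_sup (range (fun k : int =>
      ((count_window A k n)%:R / n%:R : R)%:E))).

Definition has_log_density (R : realType) (A : set int) (l : R) : Prop :=
  ((\sum_(1 <= k < n.+1 | k%:Z \in A) (k%:R : R)^-1) / ln (n%:R : R))
    @[n --> \oo] --> l.

Definition Besicovitch (R : realType) (B : set nat) : Prop :=
  exists l : R, has_density (multiples B) l.

Definition thin (R : realType) (B : set nat) : Prop :=
  (\esum_(b in B) ((b%:R : R)^-1)%:E < +oo)%E.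

Definition primitive (B : set nat) : Prop :=
  forall b b', B b -> B b' -> (b %| b')%N -> b = b'.

Definition prim (B : set nat) : set nat :=
  B `\` \bigcup_(k in [set k : nat | (2 <= k)%N]) dilate k B.

Definition Behrend (R : realType) (B : set nat) : Prop :=
  B `<=` posnat `\ 1%N /\ has_log_density (multiples B) (1 : R).

Definition behrend_quotients (R : realType) (B : set nat) : set nat :=
  [set c | posnat c /\ exists2 A, Behrend R A & dilate c A `<=` B].

Definition tautification (R : realType) (B : set nat) : set nat :=
  prim (B `|` behrend_quotients R B).

(* Main.v *)
Require Import Defs.
From HB Require Import structures.
From mathcomp Require Import all_boot all_order all_algebra.
From mathcomp Require Import all_classical all_reals all_analysis.
From mathcomp Require Import zify ring lra.

Set Implicit Arguments.
Unset Strict Implicit.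
Unset Printing Implicit Defensive.

Import Order.TTheory GRing.Theory Num.Theory.
Import numFieldNormedType.Exports.

Local Open Scope classical_set_scope.
Local Open Scope ring_scope.

(* The bounds k_i = 2 suffice when all E_i equal a single set E that is thin,
   primitive and of positive upper Banach density. Then E itself is disjoint
   from M_B: if e a divides w in E with e in E and a >= 2, primitivity gives
   e = w, and w a cannot divide w. Such an E is obtained from windows
   (N_n, N_n + n] with N_n growing so fast that the reciprocals of all window
   elements sum to at most 1/2, and with N_n divisible by every element of the
   earlier windows: keep N_n + i when no window element divides i; at least half
   of each window survives.

   For the tautification, let c A be contained in B with A Behrend, and suppose
   that no element of E divides c. As c M_A is contained in M_E, the set of all
   x such that no element of E divides c x is disjoint from M_A. Since E is
   thin, this set has positive lower density, hence positive lower logarithmic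
   density, which contradicts delta(M_A) = 1. So every element of C(B) is a
   multiple of an element of E. *)

(** * Reciprocal sums of thin sets and a union bound *)

Definition recip_sum (R : realType) (B : set nat) (m n : nat) : R :=
  \sum_(m <= b < n | b \in B) b%:R^-1.

Lemma thin_bounded (R : realType) (B : set nat) (s : R) :
  (forall n, recip_sum R B 0 n <= s) -> thin R B.
Proof.
move=> Bs; rewrite /thin -[B]set_mem_set -nneseries_esum; last first.
  by move=> n _; rewrite lee_fin invr_ge0.
apply: (@le_lt_trans _ _ s%:E); last exact: ltry.
apply: lime_le; last by apply: nearW => n; rewrite sumEFin lee_fin; exact: Bs.
by apply: is_cvg_nneseries => n _ _; rewrite lee_fin invr_ge0.
Qed.

Lemma thin_tail (R : realType) (B : set nat) (eps : R) :
  thin R B -> 0 < eps -> exists m, forall n, recip_sum R B m n <= eps.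
Proof.
rewrite /thin -{1}[B]set_mem_set -nneseries_esum; last first.
  by move=> n _; rewrite lee_fin invr_ge0.
move=> Bfin eps0.
have inv0 (b : nat) : b \in B -> (0 <= (b%:R^-1)%:E :> \bar R)%E.
  by move=> _; rewrite lee_fin invr_ge0.
have /fine_cvgP[[m1 _ fin1]] := nneseries_tail_cvg Bfin inv0.
move=> /cvgrPdist_le /(_ _ eps0)[m2 _ le2].
exists (maxn m1 m2) => n; rewrite /recip_sum -lee_fin -sumEFin.
apply: (le_trans (nneseries_lim_ge _ _)); first by move=> ? _; exact: inv0.
rewrite -(fineK (fin1 _ (leq_maxl m1 m2))) lee_fin.
have := le2 _ (leq_maxr m1 m2); rewrite /= sub0r normrN.
by apply: le_trans; exact: ler_norm.
Qed.

(** Union bound: each [t] with [P t] is charged to some [b] in [B], and [b] is charged at most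
    [s / b + d] times. The term [d] absorbs the rounding error made for each [b]. *)
Lemma count_le_recip_sum (R : realType) (B : set nat) (P : pred nat)
    (Q : rel nat) (k l m n : nat) (s d : R) :
  0 <= d ->
  (forall t, (k <= t < l)%N -> P t ->
    exists2 b, B b & (m <= b < n)%N && Q b t) ->
  (forall b, B b -> (m <= b < n)%N ->
    (\sum_(k <= t < l) Q b t)%N%:R <= s / b%:R + d) ->
  (\sum_(k <= t < l) P t)%N%:R <= s * recip_sum R B m n + d * n%:R.
Proof.
move=> d0 PQ Qle.
have : (\sum_(k <= t < l) P t <=
        \sum_(m <= b < n | b \in B) \sum_(k <= t < l) Q b t)%N.
  rewrite exchange_big /= !big_nat leq_sum// => t tkl.
  case: (boolP (P t)) => // /(PQ _ tkl)[b Bb /andP[bmn Qbt]].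
  rewrite (big_rem b) /=; last by rewrite mem_index_iota.
  by rewrite mem_set// Qbt.
rewrite -(ler_nat R) => /le_trans; apply.
rewrite natr_sum big_nat_cond /recip_sum mulr_sumr.
rewrite [X in _ <= X + _]big_nat_cond.
apply: (@le_trans _ _
    (\sum_(m <= b < n | (m <= b < n)%N && (b \in B)) (s / b%:R + d))).
  by apply: ler_sum => b /andP[bmn]; rewrite inE => Bb; exact: Qle.
rewrite big_split lerD2l /= -big_nat_cond.
rewrite big_const_seq iter_addr_0 -[d *+ _]mulr_natr ler_wpM2l// ler_nat.
by rewrite (leq_trans (count_size _ _))// size_iota leq_subr.
Qed.

(** * Counting multiples in intervals and progressions *)

Lemma divn_gcd_gt0 (e c : nat) : (0 < e)%N -> (0 < e %/ gcdn e c)%N.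
Proof. by move=> e0; rewrite divn_gt0 ?gcdn_gt0 ?e0// dvdn_leq// dvdn_gcdl. Qed.

Lemma dvdn_mulE (e c x : nat) :
  (0 < e)%N -> (e %| c * x)%N = (e %/ gcdn e c %| x)%N.
Proof.
move=> e0; set g := gcdn e c.
have g0 : (0 < g)%N by rewrite gcdn_gt0 e0.
have -> : (e %| c * x)%N = (e %/ g * g %| c %/ g * x * g)%N.
  by rewrite divnK ?dvdn_gcdl// mulnAC divnK// dvdn_gcdr.
rewrite dvdn_pmul2r// Gauss_dvdr// /coprime -(eqn_pmul2r g0) mul1n.
by rewrite muln_gcdl !divnK ?dvdn_gcdl ?dvdn_gcdr.
Qed.

Lemma ler_inv_div_gcd (R : realType) (e c : nat) : (0 < e)%N -> (0 < c)%N ->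
  ((e %/ gcdn e c)%:R^-1 : R) <= c%:R / e%:R.
Proof.
move=> e0 c0; set g := gcdn e c.
have f0 : (0 < e %/ g)%N by exact: divn_gcd_gt0.
rewrite ler_pdivlMr ?ltr0n// ler_pdivrMl ?ltr0n//.
rewrite -natrM ler_nat -{1}(divnK (dvdn_gcdl e c)) leq_mul2l.
by rewrite dvdn_leq ?orbT// dvdn_gcdr.
Qed.

(** The condition on [x] is divisibility by [e / gcd(e, c)], which is at least [e / c]. Counting
    from 1 leaves no rounding error. *)
Lemma count_dvd_mul_le (R : realType) (e c n : nat) : (0 < e)%N -> (0 < c)%N ->
  (\sum_(1 <= x < n.+1) (e %| c * x))%N%:R <= (c * n)%:R / e%:R :> R.
Proof.
move=> e0 c0; under eq_bigr do rewrite dvdn_mulE//.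
rewrite -divn_count_dvd natrM mulrAC.
set f := (e %/ gcdn e c)%N; have f0 : (0 < f)%N by exact: divn_gcd_gt0.
apply: (@le_trans _ _ (f%:R^-1 * n%:R)); last first.
  by rewrite ler_wpM2r// ler_inv_div_gcd.
by rewrite ler_pdivlMl ?ltr0n// -natrM ler_nat mulnC leq_divM.
Qed.

(** A solution forces [f] to be coprime to [L], so any two solutions agree modulo [f]. Hence
    [t %/ f] determines the solution [t], and it is at most [T %/ f]. *)
Lemma count_dvd_progression_le (L f T : nat) : (0 < f)%N ->
  (\sum_(0 <= t < T) (f %| 1 + L * t) <= T %/ f + 1)%N.
Proof.
move=> f0.
have -> : (\sum_(0 <= t < T) (f %| 1 + L * t) =
    size [seq t %/ f | t <- iota 0 T & f %| 1 + L * t])%N.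
  rewrite size_map size_filter -sum1_count [RHS]big_mkcond /index_iota subn0.
  by apply: eq_bigr => t _; case: ifP.
rewrite -[leqRHS](size_iota 0) uniq_leq_size//.
  rewrite map_inj_in_uniq ?filter_uniq ?iota_uniq// => t u.
  rewrite !mem_filter => /andP[ft _] /andP[fu _] tu.
  have cop : coprime f L.
    rewrite /coprime -dvdn1 -(@dvdn_addl (L * t)) ?dvdn_mulr ?dvdn_gcdr//.
    exact: dvdn_trans (dvdn_gcdl _ _) ft.
  wlog ltu : t u ft fu tu / (t <= u)%N.
    by move=> W; case: (leqP t u) => [|/ltnW] h; [exact: W|apply/esym/W].
  have : (f %| u - t)%N.
    rewrite -(Gauss_dvdr _ cop) mulnBr -(subnDl 1%N); exact: dvdn_sub.
  move=> fd; apply/eqP; rewrite eqn_leq ltu -subn_eq0 eqn0Ngt.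
  apply/negP => /dvdn_leq/(_ fd); have := ltn_pmod u f0.
  by have := divn_eq t f; rewrite tu; have := divn_eq u f; lia.
move=> q /mapP[t]; rewrite mem_filter mem_iota => /andP[_ tT] ->.
by rewrite mem_iota /= add0n addn1 ltnS leq_div2r//; lia.
Qed.

(** * Positive lower density of the integers avoiding a thin set of divisors *)

Definition has_divisor (B : set nat) (k : nat) : bool :=
  `[< exists2 b, B b & (b %| k)%N >].

Lemma in_multiples (B : set nat) (k : nat) :
  (k%:Z \in multiples B) = has_divisor B k.
Proof.
apply/idP/asboolP => [|[b Bb bk]].
  by rewrite inE => -[b Bb /= bk]; exists b.
by rewrite inE; exists b.
Qed.

Lemma sum_progression_le (P : pred nat) (L T n : nat) : (0 < L)%N ->
  (L * T <= n)%N ->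
  (\sum_(0 <= t < T) P (1 + L * t) <= \sum_(1 <= x < n.+1) P x)%N.
Proof.
move=> L0 LTn.
apply: (@leq_trans (\sum_(1 <= x < (L * T).+1) P x)); last first.
  by rewrite (big_cat_nat (n := (L * T).+1) (p := n.+1))//= leq_addr.
elim: T {LTn} => [|T IH]; first by rewrite big_nil.
rewrite big_nat_recr//= mulnS.
rewrite [leqRHS](@big_cat_nat _ _ _ (L * T).+1)//=; last first.
  by rewrite ltnS leq_addl.
rewrite leq_add// big_ltn ?add1n ?leq_addr//; lia.
Qed.

(* The integers x = 1 mod m!, with m so large that the tail of the reciprocal
   sum from m on is small, already suffice: some b < m can divide c x only if
   it divides c, since it is coprime to x. *)
Lemma count_no_divisor_ge (R : realType) (B : set nat) (c : nat) :
  B `<=` posnat -> thin R B -> (0 < c)%N -> ~~ has_divisor B c ->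
  exists2 a : R, 0 < a & exists C : R, forall n,
    a * n%:R - C <= (\sum_(1 <= x < n.+1) ~~ has_divisor B (c * x))%N%:R.
Proof.
move=> Bpos thinB c0 Bc.
have cR0 : 0 < c%:R :> R by rewrite ltr0n.
have [m tailm] : exists m, forall n, recip_sum R B m n <= (4 * c%:R)^-1.
  by apply: thin_tail => //; rewrite invr_gt0 mulr_gt0.
set L := m`!; have L0 : (0 < L)%N by exact: fact_gt0.
have LR0 : 0 < L%:R :> R by rewrite ltr0n.
(* A second cutoff: counting along the progression costs an error 1 per divisor, affordable only for
   the finitely many [b < m']. Larger [b] are counted over all [x <= n] without rounding error,
   which loses a factor [L] that this smaller tail repays. *)
have [m' tailm'] : exists m', forall n,
    recip_sum R B m' n <= (4 * c%:R * L%:R)^-1.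
  by apply: thin_tail => //; rewrite invr_gt0 !mulr_gt0.
exists (2 * L%:R)^-1; first by rewrite invr_gt0 mulr_gt0.
exists (m'%:R + 1) => n; set T := (n %/ L)%N.
pose good t := ~~ has_divisor B (c * (1 + L * t)).
pose bad1 t :=
  `[< exists2 b, B b & (m <= b < m')%N && (b %| c * (1 + L * t))%N >].
pose bad2 x := `[< exists2 b, B b & (m' <= b)%N && (b %| c * x)%N >].
have LT : (L * T <= n)%N by rewrite mulnC leq_divM.
have cover : (T <= \sum_(0 <= t < T) good t + \sum_(0 <= t < T) bad1 t +
                   \sum_(0 <= t < T) bad2 (1 + L * t))%N.
  rewrite -!big_split /= -[leqLHS]muln1 -[X in (X * 1)%N]subn0.
  rewrite -sum_nat_const_nat leq_sum// => t _; rewrite /good.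
  case: (boolP (has_divisor _ _)) => //= /asboolP[b Bb bd].
  have mb : (m <= b)%N.
    rewrite leqNgt; apply: contra Bc => bm; apply/asboolP; exists b => //.
    have bL : (b %| L * t)%N by rewrite dvdn_mulr// dvdn_fact// Bpos//= ltnW.
    rewrite -(@Gauss_dvdl _ _ (1 + L * t))//.
    rewrite /coprime -dvdn1 -(@dvdn_addl (L * t)) ?dvdn_gcdr//.
    exact: dvdn_trans (dvdn_gcdl _ _) bL.
  have [bm'|m'b] := ltnP b m'.
    suff -> : bad1 t by [].
    by apply/asboolP; exists b; rewrite // mb bm'.
  suff -> : bad2 (1 + L * t)%N by rewrite addn1.
  by apply/asboolP; exists b; rewrite // m'b.
have le1 : (\sum_(0 <= t < T) bad1 t)%N%:R <= T%:R / 4 + m'%:R :> R.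
  apply: (le_trans (@count_le_recip_sum R B bad1
    (fun b t => b %| c * (1 + L * t))%N 0 T m m' (c%:R * T%:R) 1 _ _ _)) => //.
  - by move=> t _ /asboolP.
  - move=> b /Bpos b0 _; under eq_bigr do rewrite dvdn_mulE//.
    set f := (b %/ gcdn b c)%N; have f0 : (0 < f)%N by exact: divn_gcd_gt0.
    apply: (@le_trans _ _ ((T %/ f + 1)%N%:R)).
      by rewrite ler_nat count_dvd_progression_le.
    rewrite natrD lerD2r mulrAC; apply: (@le_trans _ _ (f%:R^-1 * T%:R)).
      by rewrite ler_pdivlMl ?ltr0n// -natrM ler_nat mulnC leq_divM.
    by rewrite ler_wpM2r// ler_inv_div_gcd.
  rewrite mul1r lerD2r mulrAC.
  have := ler_wpM2l (ltW cR0) (tailm m').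
  rewrite invfM mulrCA divff ?gt_eqF// mulr1.
  by move=> ?; rewrite [leRHS]mulrC ler_wpM2r.
have le2 :
    (\sum_(0 <= t < T) bad2 (1 + L * t)%N)%N%:R <= n%:R / (4 * L%:R) :> R.
  apply: (@le_trans _ _ (\sum_(1 <= x < n.+1) bad2 x)%N%:R).
    by rewrite ler_nat sum_progression_le.
  apply: (le_trans (@count_le_recip_sum R B bad2
    (fun b x => b %| c * x)%N 1 n.+1 m' (c * n).+1 (c * n)%:R 0 _ _ _)) => //.
  - move=> x /andP[x0]; rewrite ltnS => xn /asboolP[b Bb /andP[m'b bcx]].
    exists b => //; rewrite m'b bcx ltnS andbT (leq_trans (dvdn_leq _ bcx))//.
      by rewrite muln_gt0 c0.
    by rewrite leq_mul2l xn orbT.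
  - by move=> b /Bpos b0 _; rewrite addr0 count_dvd_mul_le.
  rewrite mul0r addr0; apply: (le_trans (ler_wpM2l _ (tailm' _))) => //.
  by rewrite natrM !invfM le_eqVlt; apply/orP; left; apply/eqP; field; lra.
have Tn : n%:R / L%:R <= T%:R + 1 :> R.
  rewrite ler_pdivrMr// -[1]/(1%:R) -natrD -natrM ler_nat addn1.
  by rewrite ltnW// ltn_ceil.
have leg : (\sum_(0 <= t < T) good t)%N%:R <=
    (\sum_(1 <= x < n.+1) ~~ has_divisor B (c * x))%N%:R :> R.
  rewrite ler_nat.
  exact: (@sum_progression_le (fun x => ~~ has_divisor B (c * x))).
move: cover; rewrite -(ler_nat R) !natrD.
rewrite invfM mulrA mulrAC in le2.
rewrite invfM -mulrA [L%:R^-1 * _]mulrC.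
lra.
Qed.

(** * From natural to logarithmic lower density *)

Lemma ln_succ_sub (R : realType) (n : nat) : (0 < n)%N ->
  (n.+1%:R^-1 : R) <= ln (n.+1%:R : R) - ln (n%:R : R) <= n%:R^-1.
Proof.
move=> n0; have nR0 : 0 < n%:R :> R by rewrite ltr0n.
have n1R0 : 0 < n.+1%:R :> R by rewrite ltr0n.
have n1E : n.+1%:R = n%:R + 1 :> R by rewrite -natr1.
rewrite -ln_div ?posrE//; apply/andP; split.
  rewrite -[leRHS]opprK -lnV ?posrE ?divr_gt0// invf_div lerNr.
  have -> : n%:R / n.+1%:R = 1 + - n.+1%:R^-1 :> R.
    by rewrite n1E; field; rewrite -n1E gt_eqF.
  apply: le_ln1Dx; rewrite ltrN2 invf_lt1// n1E; lra.
have -> : n.+1%:R / n%:R = 1 + n%:R^-1 :> R.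
  by rewrite n1E; field; rewrite gt_eqF.
by apply: le_ln1Dx; apply: (@lt_trans _ _ 0); rewrite ?invr_gt0// ltrN10.
Qed.

Lemma harmonic_sum_le (R : realType) (n : nat) : (0 < n)%N ->
  \sum_(1 <= k < n.+1) (k%:R^-1 : R) <= ln (n%:R : R) + 1.
Proof.
elim: n => // -[_ _|n IH _]; first by rewrite big_nat1 ln1 add0r invr1.
rewrite big_nat_recr//=; move: (IH isT).
have /andP[+ _] := @ln_succ_sub R n.+1 isT; move=> le1 le2.
by apply: (le_trans (lerD le2 le1)); rewrite addrAC subrKC.
Qed.

(* Summation by parts: subtracting from the sum its boundary term
   (count up to n) / (n + 1) gives a quantity whose increments are
   (count up to n + 1) / ((n + 1) (n + 2)). *)
Lemma recip_sum_count_ge (R : realType) (P : pred nat) (a C : R) (n : nat) :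
  0 <= a -> 0 <= C ->
  (forall n, a * n%:R - C <= (\sum_(1 <= k < n.+1) P k)%N%:R) ->
  a * (ln (n.+2%:R : R) - ln 2) - C <= \sum_(1 <= k < n.+1 | P k) (k%:R^-1 : R).
Proof.
move=> a0 C0 Pge.
(* The errors [C / ((k + 1) (k + 2))] of the increments telescope to [C * (1 - 1 / (n + 1))], so
   this sharper form carries the induction. *)
suff : a * (ln (n.+2%:R : R) - ln 2) - C * (1 - (n.+1%:R : R)^-1) <=
    \sum_(1 <= k < n.+1 | P k) (k%:R^-1 : R)
    - (\sum_(1 <= k < n.+1) P k)%N%:R / n.+1%:R.
  have drop (i d u S : R) : 0 <= i -> 0 <= d ->
      u - C * (1 - i) <= S - d -> u - C <= S.
    by move=> i0 d0; have := mulr_ge0 C0 i0; lra.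
  by apply: drop; rewrite ?invr_ge0// divr_ge0.
(* Here [N1] is n + 1, [u] and [v] are 1 / (n + 1) and 1 / (n + 2), [g] is the count up to n, and
   [p] tells whether n + 1 is counted. Weighting the count bound by [u * v = u - v] yields
   [a * v - C * (u - v)], and [v] dominates [l' - l]. *)
have step (N1 u v g p l l2 l' S : R) : N1 * u = 1 -> u - v = u * v ->
    0 <= u * v -> a * N1 - C <= g + p -> l' - l <= v ->
    a * (l - l2) - C * (1 - u) <= S - g * u ->
    a * (l' - l2) - C * (1 - v) <= S + p * u - (g + p) * v.
  move=> N1u uv uv0 /(ler_wpM2r uv0) + /(ler_wpM2l a0).
  have -> : (a * N1 - C) * (u * v) = a * (N1 * u) * v - C * (u * v) by ring.
  rewrite N1u -uv; lra.
elim: n => [|n IH].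
  by rewrite !big_geq// invr1 !subrr mulr0 mul0r oppr0 mulr0 subrr.
have := Pge n.+1; have -> := @big_nat_recr _ _ addn n.+1 1%N P isT.
rewrite natrD => gp.
rewrite (big_mkcond P) [X in _ <= X - _]big_nat_recr//= -big_mkcond.
have -> : (if P n.+1 then n.+1%:R^-1 else 0) = (P n.+1)%:R * n.+1%:R^-1 :> R.
  by case: (P n.+1); rewrite ?mul1r ?mul0r.
have /andP[_ lnle] := @ln_succ_sub R n.+2 isT.
apply: (step n.+1%:R) gp lnle IH.
- by rewrite divff// pnatr_eq0.
- have : n.+2%:R = n.+1%:R + 1 :> R by rewrite -natr1.
  have : n.+1%:R != 0 :> R by rewrite pnatr_eq0.
  have : n.+2%:R != 0 :> R by rewrite pnatr_eq0.
  by move: n.+2%:R n.+1%:R => x y + + xE; subst x => y0 x0; field; apply/andP.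
- by rewrite mulr_ge0// invr_ge0.
Qed.

(** All reciprocals up to n sum to at most ln n + 1, and the complement of [M] takes at least a ln n
    - O(1) of this, so the ratio for [M] ends below 1 - a / 2. *)
Lemma log_density_neq1 (R : realType) (M : set int) (a C : R) : 0 < a ->
  (forall n, a * n%:R - C <= (\sum_(1 <= k < n.+1) (k%:Z \notin M))%N%:R) ->
  ~ has_log_density M (1 : R).
Proof.
move=> a0 Mge; rewrite /has_log_density => /cvgrPdist_le /(_ (a / 2)).
case; first by rewrite divr_gt0.
wlog C0 : C Mge / 0 <= C.
  move=> /(_ `|C|); apply => // n.
  by apply: le_trans (Mge n); rewrite lerD2l lerN2 ler_norm.
move=> N _ Nle.
(* Chosen so that ln n > [X] makes (a / 2) ln n exceed the bounded terms 1 + a ln 2 + C. *)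
pose X := 2 / a * (1 + a * ln 2 + C) + 1.
pose n := (maxn N (Num.truncn (expR X)).+1).+1.
have lnn : X < ln n%:R.
  rewrite -ltr_expR lnK ?posrE ?ltr0n//.
  apply: lt_le_trans (truncnS_gt _) _.
  by rewrite ler_nat leqW// leq_maxr.
have := Nle n (leq_trans (leq_maxl _ _) (leqnSn _)).
have := recip_sum_count_ge n (ltW a0) C0 Mge.
have := @harmonic_sum_le R n isT.
rewrite (bigID (fun k : nat => k%:Z \in M))/=.
set S := \sum_(_ <= _ < _ | _) _; set S' := \sum_(_ <= _ < _ | _) _.
move=> H1 H2 /(le_trans (ler_norm _)).
have lnn2 : ln n%:R <= ln n.+2%:R :> R.
  by rewrite ler_ln ?posrE ?ltr0n// ler_nat ltnW.
have ln2 : 0 < ln 2 :> R by rewrite ln_gt0// ltr1n.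
have lnn0 : 0 < ln n%:R :> R.
  apply: lt_trans lnn; rewrite ltr_wpDl// mulr_ge0 ?divr_ge0 ?(ltW a0)//.
  by rewrite !addr_ge0// mulr_ge0 ?ltW.
rewrite lerBlDr -lerBlDl ler_pdivlMr// => H3.
have : a * ln n%:R <= a * ln n.+2%:R by rewrite ler_wpM2l// ltW.
have : a / 2 * X < a / 2 * ln n%:R by rewrite ltr_pM2l// divr_gt0.
have -> : a / 2 * X = 1 + a * ln 2 + C + a / 2.
  by rewrite /X; field; rewrite gt_eqF.
move: (ln n%:R) (ln 2) (ln n.+2%:R) H1 H2 H3 => l l2 l'.
lra.
Qed.

(** * Thin sets are Besicovitch *)

(** The slope [l] may change with [eps]: the quotients eventually stay within any given distance of
    some number, so they form a Cauchy sequence. *)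
Lemma cvg_div_nat (R : realType) (u : nat -> R) :
  (forall eps : R, 0 < eps ->
    exists l C : R, forall n, `|u n - l * n%:R| <= eps * n%:R + C) ->
  cvgn (fun n => u n / n%:R).
Proof.
move=> ul; apply/cauchy_cvgP/cauchy_exP => eps eps0.
have [l [C uC]] := ul (eps / 2) (divr_gt0 eps0 (ltr0n _ 2)).
exists l; exists (Num.truncn (2 * C / eps)).+1 => // n /= nge.
have n0 : 0 < n%:R :> R by rewrite ltr0n (leq_trans _ nge).
have Cn : 2 * C < eps * n%:R.
  rewrite [ltRHS]mulrC -ltr_pdivrMr//; apply: lt_le_trans (truncnS_gt _) _.
  by rewrite ler_nat.
rewrite /ball /= -(ltr_pM2r n0) -{2}(ger0_norm (ltW n0)) -normrM mulrBl.
rewrite divfK ?gt_eqF// distrC; apply: le_lt_trans (uC n) _; lra.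
Qed.

(** With c the counting function, c(q L + r) = q c(L) + c(r), so the slope is c(L) / L and only the
    incomplete last period contributes an error. *)
Lemma periodic_count_le (R : realType) (P : pred nat) (L : nat) : (0 < L)%N ->
  (forall i, P (i + L)%N = P i) ->
  exists l : R, forall n,
    `|(\sum_(1 <= i < n.+1) P i)%N%:R - l * n%:R| <= L%:R.
Proof.
move=> L0 PL; pose c n := (\sum_(1 <= i < n.+1) P i)%N.
have c0 : c 0%N = 0%N by rewrite /c big_geq.
have cS n : c n.+1 = (c n + P n.+1)%N by rewrite /c big_nat_recr.
have cle n : (c n <= n)%N.
  by elim: n => [|n IH]; rewrite ?c0// cS -[leqRHS]addn1 leq_add// leq_b1.
have cD n : c (n + L)%N = (c n + c L)%N.
  elim: n => [|n IH]; first by rewrite c0.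
  by rewrite addSn !cS IH -addSn PL addnAC.
have cM q r : c (q * L + r)%N = (q * c L + c r)%N.
  by elim: q => // q IH; rewrite !mulSn -addnA addnC cD IH addnC addnA.
exists ((c L)%:R / L%:R) => n; rewrite -/(c n).
have LR0 : 0 < L%:R :> R by rewrite ltr0n.
have rL : (n %% L <= L)%N by rewrite ltnW// ltn_pmod.
have -> : (c n)%:R - (c L)%:R / L%:R * n%:R =
    (c (n %% L)%N)%:R - (c L)%:R / L%:R * (n %% L)%N%:R :> R.
  rewrite {1 2}(divn_eq n L) cM; move: (n %/ L)%N (n %% L)%N => q r.
  by rewrite !natrD !natrM; field; rewrite gt_eqF.
have h1 : (c (n %% L)%N)%:R <= L%:R :> R.
  by rewrite ler_nat (leq_trans (cle _)).
have h2 : (c L)%:R / L%:R * (n %% L)%N%:R <= L%:R :> R.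
  by rewrite mulrAC ler_pdivrMr// -!natrM ler_nat leq_mul.
have h3 : 0 <= (c L)%:R / L%:R * (n %% L)%N%:R :> R.
  by rewrite mulr_ge0// divr_ge0.
have h4 : 0 <= (c (n %% L)%N)%:R :> R by exact: ler0n.
by rewrite ler_norml; apply/andP; split; lra.
Qed.

(** Divisibility by some [b < m] is periodic with period m!, and the remaining [b] add at most
    [eps * n] integers by the tail bound. *)
Lemma thin_Besicovitch (R : realType) (B : set nat) :
  B `<=` posnat -> thin R B -> Besicovitch R B.
Proof.
move=> Bpos thinB; apply/cvg_ex.
apply: (@cvg_div_nat R (fun n => (count_window (multiples B) 0 n)%:R)).
move=> eps eps0.
have [m tailm] := thin_tail thinB eps0.
pose P := has_divisor (B `&` [set b | (b < m)%N]).
pose Q x := `[< exists2 b, B b & (m <= b)%N && (b %| x)%N >].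
have Pper i : P (i + m`!)%N = P i.
  by apply/asboolP/asboolP => -[b [Bb bm] bi]; exists b => //; move: bi;
    rewrite dvdn_addl// dvdn_fact// Bpos//= ltnW.
have [l cP] := periodic_count_le R (fact_gt0 m) Pper.
exists l, (m`!)%:R => n; set c := count_window _ _ _.
have leP : (\sum_(1 <= i < n.+1) P i <= c)%N.
  apply: leq_sum => i _; rewrite add0r in_multiples.
  case: (boolP (P i)) => // /asboolP[b [Bb _] bi].
  by rewrite lt0b; apply/asboolP; exists b.
have leQ : (c <= \sum_(1 <= i < n.+1) P i + \sum_(1 <= i < n.+1) Q i)%N.
  rewrite -big_split leq_sum//= => i _; rewrite add0r in_multiples.
  case: (boolP (has_divisor B i)) => // /asboolP[b Bb bi].
  have [bm|mb] := ltnP b m.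
    suff -> : P i by [].
    by apply/asboolP; exists b.
  suff -> : Q i by rewrite addn1.
  by apply/asboolP; exists b; rewrite ?mb.
have Qle : (\sum_(1 <= i < n.+1) Q i)%N%:R <= eps * n%:R.
  apply: (le_trans (@count_le_recip_sum R B Q (fun b x => b %| x)%N
    1 n.+1 m n.+1 n%:R 0 _ _ _)) => //.
  - move=> i /andP[i0]; rewrite ltnS => iltn /asboolP[b Bb /andP[mb bi]].
    by exists b; rewrite // mb bi ltnS andbT (leq_trans (dvdn_leq i0 bi)).
  - move=> b /Bpos b0 _; have := @count_dvd_mul_le R b 1 n b0 isT.
    by rewrite addr0 mul1n; under eq_bigr do rewrite mul1n.
  by rewrite mul0r addr0 mulrC ler_wpM2r.
move: leP leQ; rewrite -!(ler_nat R) natrD => leP leQ.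
have := cP n; rewrite !ler_norml => /andP[lo hi].
by apply/andP; split; have := mulr_ge0 (ltW eps0) (ler0n R n); lra.
Qed.

(** * The sparse primitive set built from windows *)

(** The factorial makes each start a multiple of every positive integer up to the end of the
    previous window; the other factors make the reciprocals of window k sum to at most 2^-(k + 1).
    The window of index 0 is empty. *)
Fixpoint window_start (n : nat) : nat :=
  if n is m.+1 then (m.+1 * 2 ^ m.+2 * (window_start m + m)`!)%N else 1%N.

Definition windows : set nat :=
  [set w | exists n i, (0 < i <= n)%N /\ w = (window_start n + i)%N].

Definition sparse_set : set nat :=
  [set w | exists n i, [/\ (0 < i <= n)%N, w = (window_start n + i)%N &
                           ~~ has_divisor windows i]].

Lemma window_startS (n : nat) : window_start n.+1 =
  (n.+1 * 2 ^ n.+2 * (window_start n + n)`!)%N.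
Proof. by []. Qed.

Lemma window_start_ge (n : nat) : (n.+1 * 2 ^ n.+2 <= window_start n.+1)%N.
Proof. by rewrite window_startS leq_pmulr// fact_gt0. Qed.

Lemma leq_window_start (n : nat) : (n <= window_start n)%N.
Proof.
case: n => // n; apply: leq_trans (window_start_ge n).
by rewrite leq_pmulr// expn_gt0.
Qed.

Lemma window_start_gt0 (n : nat) : (0 < window_start n)%N.
Proof. by case: n => // n; rewrite (leq_trans _ (leq_window_start _)). Qed.

Lemma dvdn_window_start (d n m : nat) : (n < m)%N ->
  (0 < d <= window_start n + n)%N -> (d %| window_start m)%N.
Proof.
elim: m => // m IH; rewrite ltnS leq_eqVlt => /predU1P[->|nm] d0;
  rewrite window_startS dvdn_mull//; first exact: dvdn_fact.
apply: dvdn_trans (IH nm d0) _.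
by rewrite dvdn_fact// window_start_gt0 leq_addr.
Qed.

Lemma window_start_lt (n m : nat) : (n < m)%N ->
  (window_start n + n < window_start m)%N.
Proof.
elim: m => // m IH; rewrite ltnS leq_eqVlt => nm.
apply: (@leq_ltn_trans (window_start m + m)).
  by case/predU1P: nm => [->//|/IH/ltnW/leq_trans]; apply; exact: leq_addr.
rewrite window_startS; apply: leq_ltn_trans (fact_geq _) _.
rewrite -[ltnLHS]mul1n ltn_pmul2r ?fact_gt0// expnS mulnCA.
by rewrite leq_pmulr// muln_gt0 expn_gt0.
Qed.

Lemma recip_sum_windows (R : realType) (n : nat) :
  recip_sum R windows 0 n <= 2^-1.
Proof.
apply: (@le_trans _ _ (\sum_(0 <= k < n) k%:R / (window_start k)%:R)).
  rewrite /recip_sum big_mkcond /=.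
  (* Summing over all windows that contain [b] avoids appealing to their disjointness; only indices
     [k < n] occur because [window_start k >= k]. *)
  apply: (@le_trans _ _ (\sum_(0 <= b < n) \sum_(0 <= k < n)
      if (window_start k < b <= window_start k + k)%N
      then (window_start k)%:R^-1 else 0)).
    apply: ler_sum_nat => b bn; case: ifPn => [|_]; last first.
      by apply: sumr_ge0 => k _; case: ifP.
    rewrite inE => -[k [i [/andP[i0 ik] bE]]].
    have kn : (k < n)%N by have := leq_window_start k; lia.
    rewrite (big_rem k) /=; last by rewrite mem_index_iota.
    rewrite bE -addn1 leq_add2l i0 leq_add2l ik ler_wpDr//.
      by apply: sumr_ge0 => k' _; case: ifP.
    rewrite lef_pV2 ?posrE ?ltr0n ?addn_gt0 ?window_start_gt0//.
    by rewrite ler_nat leq_addr.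
  rewrite exchange_big /=; apply: ler_sum_nat => k _.
  rewrite -big_mkcond big_const_seq iter_addr_0 -[leLHS]mulr_natl.
  rewrite ler_wpM2r// ler_nat.
  rewrite -size_filter -[leqRHS](size_iota (window_start k).+1) uniq_leq_size//.
    by rewrite filter_uniq// iota_uniq.
  move=> b; rewrite mem_filter mem_iota => /andP[/andP[h1 h2] _].
  by rewrite h1 addSn ltnS.
have geom m : \sum_(0 <= k < m.+1) k%:R / (window_start k)%:R <=
    2^-1 - (2 ^+ m.+1)^-1 :> R.
  elim: m => [|m IH]; first by rewrite big_nat1 mul0r expr1 subrr.
  rewrite big_nat_recr//.
  have le1 : m.+1%:R / (window_start m.+1)%:R <= (2 ^+ m.+2)^-1 :> R.
    rewrite ler_pdivrMr ?ltr0n ?window_start_gt0// ler_pdivlMl ?exprn_gt0//.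
    rewrite -natrX -natrM ler_nat mulnC.
    exact: window_start_ge.
  have eq2 : (2 ^+ m.+1)^-1 = (2 ^+ m.+2)^-1 + (2 ^+ m.+2)^-1 :> R.
    by rewrite [2 ^+ m.+2]exprS invfM; lra.
  apply: le_trans (lerD IH le1) _; rewrite eq2; lra.
case: n => [|n]; first by rewrite big_geq ?invr_ge0.
by apply: le_trans (geom n) _; rewrite gerBl invr_ge0 exprn_ge0.
Qed.

Lemma sparse_set_pos : sparse_set `<=` posnat.
Proof.
by move=> w [n [i [/andP[i0 _] -> _]]]; rewrite /posnat/= addn_gt0 i0 orbT.
Qed.

Lemma thin_sparse_set (R : realType) : thin R sparse_set.
Proof.
apply: (@thin_bounded _ _ 2^-1) => n; apply: le_trans (recip_sum_windows R n).
rewrite /recip_sum !(big_mkcond (fun b => b \in _)) ler_sum// => b _.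
case: ifPn => [|_]; last by case: ifP.
rewrite inE => -[k [i [ik bE _]]].
by case: ifPn => //; rewrite notin_setE; case; exists k, i.
Qed.

(** Let [b] lie in window n and [b'] in window m. If n < m, then [b] divides the start of window m,
    hence the offset [j] of [b'], which the sieve forbids. If m < n, then [b'] is too small. If n =
    m, then [b' < 2 b], since offsets do not exceed the window start. *)
Lemma primitive_sparse_set : primitive sparse_set.
Proof.
move=> b b' [n [i [/andP[i0 ilen] bE _]]] [m [j [/andP[j0 jm] b'E Wj]]] bb'.
have [nm|mn|nm] := ltngtP n m.
- case/negP: Wj; apply/asboolP; exists b; first by exists n, i; rewrite i0.
  rewrite -(@dvdn_addr (window_start m)) -?b'E//.
  apply: (@dvdn_window_start _ n) => //.
  by rewrite bE addn_gt0 i0 orbT leq_add2l.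
- have := window_start_lt mn.
  have b'0 : (0 < b')%N by rewrite b'E addn_gt0 j0 orbT.
  by have := dvdn_leq b'0 bb'; lia.
- subst m; have leni := leq_window_start n.
  have b'0 : (0 < b')%N by rewrite b'E addn_gt0 j0 orbT.
  case/dvdnP: bb' => -[|[|q]]; rewrite ?mul1n// => b'b; first by lia.
  by exfalso; move: b'b; rewrite b'E bE !mulSn; lia.
Qed.

(** The lost offsets are multiples of window elements, so there are at most n times the reciprocal
    sum of [windows] of them. *)
Lemma count_sparse_set_window (R : realType) (n : nat) :
  n%:R / 2 <=
  (\sum_(1 <= i < n.+1) (window_start n + i \in sparse_set)%N)%N%:R :> R.
Proof.
have : (n <= \sum_(1 <= i < n.+1) (window_start n + i \in sparse_set)%N +
             \sum_(1 <= i < n.+1) has_divisor windows i)%N.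
  rewrite -big_split /= -[leqLHS]muln1 -[X in (X * 1)%N](subn1 n.+1).
  rewrite -sum_nat_const_nat !big_nat leq_sum// => i iltn.
  case: (boolP (has_divisor _ _)) => [_|Wi]; first by rewrite addn1.
  by rewrite addn0 mem_set//; exists n, i.
rewrite -(ler_nat R) natrD; set S := (X in _ <= _ + X -> _).
suff : S <= n%:R / 2 by lra.
apply: (le_trans (@count_le_recip_sum R windows (has_divisor windows)
  (fun b x => b %| x)%N 1 n.+1 0 n.+1 n%:R 0 _ _ _)) => //.
- move=> i /andP[i0]; rewrite ltnS => iltn /asboolP[b Bb bi].
  by exists b; rewrite // bi ltnS andbT (leq_trans (dvdn_leq i0 bi)).
- move=> b [k [i [/andP[i0 _] bE]]] _.
  have b0 : (0 < b)%N by rewrite bE addn_gt0 i0 orbT.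
  have := @count_dvd_mul_le R b 1 n b0 isT.
  by rewrite addr0 mul1n; under eq_bigr do rewrite mul1n.
by rewrite mul0r addr0 ler_wpM2l// recip_sum_windows.
Qed.

(** * Banach density bound, tautification and conclusion *)

Lemma upper_Banach_density_ge (R : realType) (A : set int) (a : R) :
  (forall n, exists k : int, a * n%:R <= (count_window A k n)%:R) ->
  (a%:E <= upper_Banach_density R A)%E.
Proof.
(* The limit superior is an infimum of suprema over neighbourhoods [V] of infinity; each [V]
   contains a nonzero length [N.+1], whose best window already gives [a]. *)
move=> Aa; apply: le_ereal_inf_tmp => _ [V [N _ VN] <-].
have [k ak] := Aa N.+1.
apply: (@le_trans _ _ ((count_window A k N.+1)%:R / N.+1%:R)%:E).
  by rewrite lee_fin ler_pdivlMr// ltr0n.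
apply: le_trans (ereal_sup_ubound _); last first.
  by exists N.+1 => //; exact: VN (leqnSn N).
by apply: ereal_sup_ubound; exists k.
Qed.

(** Every element of B or C(B) is a multiple of an element of [E], and [E] lies in C(B). Since [E]
    is primitive, it consists exactly of the elements of the union that are not proper multiples of
    others. *)
Lemma tautification_eq (R : realType) (E B : set nat) :
  E `<=` posnat -> thin R E -> primitive E ->
  B `<=` posnat -> (forall b, B b -> has_divisor E b) ->
  E `<=` behrend_quotients R B -> tautification R B = E.
Proof.
move=> Epos thinE primE Bpos BE EC.
have CE c : behrend_quotients R B c -> has_divisor E c.
  move=> [c0 [A [_ A1] cAB]]; apply/negPn/negP => cE.
  have [a a0 [C aC]] := count_no_divisor_ge Epos thinE c0 cE.
  apply: (log_density_neq1 a0) A1 => n; apply: le_trans (aC n) _.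
  rewrite ler_nat leq_sum// => k _; rewrite in_multiples.
  case: (boolP (has_divisor A k)) => [|_]; last exact: leq_b1.
  move=> /asboolP[a' Aa' a'k].
  have /BE/asboolP[e Ee eca] : B (c * a')%N by apply: cAB; exists a'.
  suff -> : has_divisor E (c * k) by [].
  by apply/asboolP; exists e => //; apply: dvdn_trans eca (dvdn_mul _ _).
have divE x : (B `|` behrend_quotients R B) x -> has_divisor E x.
  by case=> [/BE|/CE].
have pos x : (B `|` behrend_quotients R B) x -> (0 < x)%N by case=> [/Bpos|[]].
apply/seteqP; split => x.
  move=> [Cx xmin]; have /asboolP[e Ee /dvdnP[[|[|k]] xE]] := divE _ Cx.
  - by have := pos _ Cx; rewrite xE.
  - by rewrite xE mul1n.
  - by case: xmin; exists k.+2 => //; exists e => //; right; exact: EC.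
move=> Ex; split; first by right; exact: EC.
move=> [k /= k2 [y Cy yx]]; have /asboolP[e Ee ey] := divE _ Cy.
have ex : e = x by apply: primE => //; rewrite -yx dvdn_mull.
by have := dvdn_leq (pos _ Cy) ey; have := pos _ Cy; rewrite ex -yx; nia.
Qed.

Theorem theorem1p12 (R : realType) :
  exists E_ : nat -> set nat,
    let E := \bigcup_i E_ i in
    (forall i, E_ i `<=` posnat) /\
    thin R E /\ Besicovitch R E /\ primitive E /\
    exists k : nat -> nat,
      (forall i, posnat (k i)) /\
      forall K : nat -> nat, (forall i, (k i <= K i)%N) ->
      forall A : nat -> set nat,
        (forall i, A i !=set0 /\ A i `<=` [set n | (K i <= n)%N]) ->
        let B := \bigcup_i prodset (E_ i) (A i) in
        (0 < upper_Banach_density R (multiples E `\` multiples B))%E /\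
        ((forall i, Behrend R (A i)) -> tautification R B = E).
Proof.
exists (fun=> sparse_set).
rewrite /= (bigcup_const _ (ex_intro _ 0%N I)).
split=> [_|]; first exact: sparse_set_pos.
split; first exact: thin_sparse_set.
split; first exact: thin_Besicovitch sparse_set_pos (thin_sparse_set R).
split; first exact: primitive_sparse_set.
exists (fun=> 2%N); split=> // K K2 A AK; set B := \bigcup_i _.
have A2 i a : A i a -> (2 <= a)%N.
  by move=> Aa; rewrite (leq_trans (K2 i))//; exact: (AK i).2.
split.
  apply: (@lt_le_trans _ _ (2^-1)%:E); first by rewrite lte_fin invr_gt0.
  apply: upper_Banach_density_ge => n; exists (window_start n)%:Z.
  rewrite mulrC; apply: le_trans (count_sparse_set_window R n) _.
  rewrite ler_nat leq_sum// => i _; rewrite -PoszD.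
  case: (boolP (_ \in sparse_set)) => //; rewrite inE.
  move: (window_start n + i)%N => w Ew; rewrite mem_set//.
  split; first by exists w => /=.
  move=> [_ [j _ [e Ee [a Aa <-]]] /= eaw].
  have ew : e = w.
    apply: primitive_sparse_set => //; apply: dvdn_trans eaw.
    exact: dvdn_mulr.
  have := sparse_set_pos Ew; rewrite /posnat/= => w0.
  by have := dvdn_leq w0 eaw; have := A2 _ _ Aa; rewrite ew; nia.
move=> AB; apply: tautification_eq.
- exact: sparse_set_pos.
- exact: thin_sparse_set.
- exact: primitive_sparse_set.
- move=> _ [j _ [e Ee [a Aa <-]]]; rewrite /posnat/= muln_gt0.
  by rewrite (sparse_set_pos Ee) ltnW// (A2 _ _ Aa).
- move=> _ [j _ [e Ee [a Aa <-]]]; apply/asboolP; exists e => //.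
  exact: dvdn_mulr.
- move=> e Ee; split; first exact: sparse_set_pos.
  (* All E_i coincide, so [e] times the single Behrend set [A 0] already lies in [B]. *)
  exists (A 0%N) => // _ [a Aa <-]; exists 0%N => //.
  by exists e => //; exists a.
Qed.
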